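(* Let $k\in\mathbb{Z}$ with $k\le-3$, let $i,j\in\{\frac{k+1}{2},\dots,-\frac12\}$ and $s,t\in\mathbb{Z}$. Equip $0,\infty\in\mathbb{CP}^1$ with the coordinates $z$ and $w=1/z$. Then, for each choice of sign, $$\mathcal{H}\big((0,\infty),(D^{\pm,k,s}_i,D^{\mp,k,-t}_j)\big)\cong\delta_{s,t}\delta_{i,j}\mathbb{C},$$ i.e. this space of two-point conformal blocks is one-dimensional if $i=j$ and $s=t$, and zero otherwise.
   Context: $\widehat{\mathfrak{sl}}_2$ has generators $J^a_n$ ($a\in\{+,-,0\}$, $n\in\mathbb{Z}$), $K$, $d$ with $[J^+_m,J^-_n]=J^0_{m+n}+Km\delta_{m+n,0}$, $[J^0_m,J^\pm_n]=\pm2J^\pm_{m+n}$, $[J^0_m,J^0_n]=2Km\delta_{m+n,0}$, $[J^\pm_m,J^\pm_n]=0$, $[d,J^a_n]=nJ^a_n$, $K$ central; $\mathfrak{sl}_2=\mathrm{span}\{J^+,J^-,J^0\}$ with $J^a\equiv J^a_0$. For $j\in-\tfrac12\mathbb{N}$, $D^+_j$ is the $\mathfrak{sl}_2$-module with basis $\{|j,m\rangle_+\}_{m\ge0}$, $J^0|j,m\rangle_+=2(m-j)|j,m\rangle_+$, $J^+|j,m\rangle_+=\sqrt{(m+1)(m-2j)}|j,m+1\rangle_+$, $J^-|j,m\rangle_+=-\sqrt{m(m-1-2j)}|j,m-1\rangle_+$; $D^-_j$ has basis $\{|j,m\rangle_-\}_{m\ge0}$, $J^0|j,m\rangle_-=2(j-m)|j,m\rangle_-$,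 $J^+|j,m\rangle_-=-\sqrt{m(m-1-2j)}|j,m-1\rangle_-$, $J^-|j,m\rangle_-=\sqrt{(m+1)(m-2j)}|j,m+1\rangle_-$. With $\mathfrak{r}_+=\mathrm{span}\{J^a_n:n\ge1\}$, $\mathfrak{k}=\mathrm{span}\{J^a_0,K,d\}$, the prolongation at level $k$ is $(D^\pm_j)^k=\mathcal{U}(\widehat{\mathfrak{sl}}_2)\otimes_{\mathcal{U}(\mathfrak{k}\oplus\mathfrak{r}_+)}D^\pm_j$ where $K$ acts as $k$, $\mathfrak{r}_+$ as $0$ and $d$ as $-\frac{j(j+1)}{k+2}$ on $D^\pm_j$. The spectral flow automorphism $\vartheta_s$ is $J^\pm_n\mapsto J^\pm_{n\mp s}$, $J^0_n\mapsto J^0_n-sK\delta_{n,0}$, $K\mapsto K$, $d\mapsto d+\frac s2J^0_0-\frac{s^2}4K$; for a module $(W,\rho)$, $W^s=(W,\rho\circ\vartheta_s)$; $D^{\pm,k,s}_j=((D^\pm_j)^k)^s$. Conformal blocks at $0,\infty$: for $\widehat{\mathfrak{sl}}_2$-modules $W_1,W_2$, the Lie algebra $\mathfrak{sl}_2\otimes\mathbb{C}[z,z^{-1}]$ (functions regular away from $0,\infty$) acts on $W_1\otimes W_2$ by $J^a\otimes z^n\mapsto J^a_n\otimes\mathbf 1+\mathbf 1\otimes J^a_{-n}$ (Laurent expansion at $0$ in $z$ and at $\infty$ in $w=1/z$). $\mathcal{H}((0,\infty),(W_1,W_2))$ is the space of linear functionals $\beta$ on $W_1\otimes W_2$ with $\beta\circ(J^a_n\otimes\mathbf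 1+\mathbf 1\otimes J^a_{-n})=0$ for all $a\in\{+,-,0\}$, $n\in\mathbb{Z}$. *)

(* Defs.v *)
From HB Require Import structures.
From mathcomp Require Import all_boot all_order all_algebra.
From mathcomp Require Import complex.
From mathcomp Require Import Rstruct.
Set Implicit Arguments. Unset Strict Implicit. Unset Printing Implicit Defensive.
Import Order.TTheory GRing.Theory Num.Theory.
Local Open Scope ring_scope.

Definition CC : numClosedFieldType := complex Rdefinitions.R.

(* Basis of \hat{sl}_2 : J^+_n, J^-_n, J^0_n (n in Z), K, d. *)
Inductive gen := GJp of int | GJm of int | GJ0 of int | GK | Gd.

Section Rep.
Variable V : lmodType CC.

Definition comm (rho : gen -> V -> V) (x y : gen) (v : V) : V :=
  rho x (rho y v) - rho y (rho x v).

(* rho (extended linearly) is a representation of \hat{sl}_2 on V. *)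
Definition hsl2_rep (rho : gen -> V -> V) : Prop :=
  (forall x (c : CC) u v, rho x (c *: u + v) = c *: rho x u + rho x v) /\
  [/\
      (forall (m n : int) v, comm rho (GJp m) (GJm n) v =
           rho (GJ0 (m + n)) v + (m%:~R * (m + n == 0)%:R) *: rho GK v),
      (forall (m n : int) v, comm rho (GJ0 m) (GJp n) v = 2 *: rho (GJp (m + n)) v),
      (forall (m n : int) v, comm rho (GJ0 m) (GJm n) v = - (2 *: rho (GJm (m + n)) v)) &
      (forall (m n : int) v, comm rho (GJ0 m) (GJ0 n) v =
           (2 * m%:~R * (m + n == 0)%:R) *: rho GK v)] /\
   [/\ (forall (m n : int) v, comm rho (GJp m) (GJp n) v = 0),
       (forall (m n : int) v, comm rho (GJm m) (GJm n) v = 0),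
       (forall (n : int) v, comm rho Gd (GJp n) v = n%:~R *: rho (GJp n) v),
       (forall (n : int) v, comm rho Gd (GJm n) v = n%:~R *: rho (GJm n) v) &
       (forall (n : int) v, comm rho Gd (GJ0 n) v = n%:~R *: rho (GJ0 n) v)] /\
  (forall x v, comm rho GK x v = 0).

(* Spectral flow: W^s = (W, rho \o vartheta_s). *)
Definition sflow (s : int) (rho : gen -> V -> V) : gen -> V -> V :=
  fun g v => match g with
  | GJp n => rho (GJp (n - s)) v
  | GJm n => rho (GJm (n + s)) v
  | GJ0 n => rho (GJ0 n) v - (s%:~R * (n == 0)%:R) *: rho GK v
  | GK => rho GK v
  | Gd => rho Gd v + (s%:~R / 2) *: rho (GJ0 0) v - (s%:~R ^+ 2 / 4) *: rho GK v
  end.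

(* e m is the image of the basis vector |j,m>_{+} (eps = true) or |j,m>_{-}
   (eps = false): the sl_2 action of D^{+/-}_j. *)
Definition Dsl2_rel (eps : bool) (j : CC) (rho : gen -> V -> V) (e : nat -> V) : Prop :=
  if eps then
   [/\ forall m : nat, rho (GJ0 0) (e m) = (2 * (m%:R - j)) *: e m,
       forall m : nat, rho (GJp 0) (e m) = sqrtC (m.+1%:R * (m%:R - 2 * j)) *: e m.+1 &
       forall m : nat, rho (GJm 0) (e m) =
          - (sqrtC (m%:R * (m%:R - 1 - 2 * j)) *: e m.-1)]
  else
   [/\ forall m : nat, rho (GJ0 0) (e m) = (2 * (j - m%:R)) *: e m,
       forall m : nat, rho (GJp 0) (e m) =
          - (sqrtC (m%:R * (m%:R - 1 - 2 * j)) *: e m.-1) &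
       forall m : nat, rho (GJm 0) (e m) = sqrtC (m.+1%:R * (m%:R - 2 * j)) *: e m.+1].
(* (for m = 0 the coefficient sqrt(0) = 0, so e m.-1 plays no role) *)

(* The k + r_+ -module structure of D^{+/-}_j at level k:
   sl_2 as above, K acts as k, r_+ as 0, d as -j(j+1)/(k+2). *)
Definition prol_rel (eps : bool) (j : CC) (k : int) (rho : gen -> V -> V) (e : nat -> V)
  : Prop :=
  [/\ Dsl2_rel eps j rho e,
      forall m : nat, rho GK (e m) = k%:~R *: e m,
      forall (n : int) (m : nat), 0 < n ->
        [/\ rho (GJp n) (e m) = 0, rho (GJm n) (e m) = 0 & rho (GJ0 n) (e m) = 0] &
      forall m : nat, rho Gd (e m) = (- (j * (j + 1)) / (k%:~R + 2)) *: e m].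
End Rep.

(* (V, rho) together with e : D^{eps}_j -> V (given on the basis |j,m>) is the
   prolongation (D^{eps}_j)^k = U(g^) (x)_{U(k + r_+)} D^{eps}_j, characterised by
   the universal property of the induced module. *)
Definition is_prolongation (eps : bool) (j : CC) (k : int)
  (V : lmodType CC) (rho : gen -> V -> V) (e : nat -> V) : Prop :=
  [/\ hsl2_rep rho, prol_rel eps j k rho e &
   forall (M : lmodType CC) (sigma : gen -> M -> M) (f : nat -> M),
     hsl2_rep sigma -> prol_rel eps j k sigma f ->
     (exists g : V -> M,
        [/\ forall (c : CC) u v, g (c *: u + v) = c *: g u + g v,
            forall x v, g (rho x v) = sigma x (g v) &
            forall m, g (e m) = f m]) /\
     (forall g1 g2 : V -> M,
        (forall (c : CC) u v, g1 (c *: u + v) = c *: g1 u + g1 v) ->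
        (forall x v, g1 (rho x v) = sigma x (g1 v)) ->
        (forall m, g1 (e m) = f m) ->
        (forall (c : CC) u v, g2 (c *: u + v) = c *: g2 u + g2 v) ->
        (forall x v, g2 (rho x v) = sigma x (g2 v)) ->
        (forall m, g2 (e m) = f m) ->
        forall v, g1 v = g2 v)].

(* Conformal blocks at (0, infinity): linear functionals on W1 (x) W2, i.e.
   bilinear forms on W1 x W2, annihilated by J^a_n (x) 1 + 1 (x) J^a_{-n}. *)
Definition conf_block (V1 V2 : lmodType CC) (rho1 : gen -> V1 -> V1)
  (rho2 : gen -> V2 -> V2) (beta : V1 -> V2 -> CC) : Prop :=
  [/\ forall (c : CC) u u' v, beta (c *: u + u') v = c * beta u v + beta u' v,
      forall (c : CC) u v v', beta u (c *: v + v') = c * beta u v + beta u v',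
      forall (n : int) u v, beta (rho1 (GJp n) u) v + beta u (rho2 (GJp (- n)) v) = 0,
      forall (n : int) u v, beta (rho1 (GJm n) u) v + beta u (rho2 (GJm (- n)) v) = 0 &
      forall (n : int) u v, beta (rho1 (GJ0 n) u) v + beta u (rho2 (GJ0 (- n)) v) = 0].

Definition blocks_dim1 (V1 V2 : lmodType CC) (rho1 : gen -> V1 -> V1)
  (rho2 : gen -> V2 -> V2) : Prop :=
  exists beta0, [/\ conf_block rho1 rho2 beta0,
    exists u v, beta0 u v != 0 &
    forall beta, conf_block rho1 rho2 beta ->
      exists c : CC, forall u v, beta u v = c * beta0 u v].

Definition blocks_zero (V1 V2 : lmodType CC) (rho1 : gen -> V1 -> V1)
  (rho2 : gen -> V2 -> V2) : Prop :=
  forall beta, conf_block rho1 rho2 beta -> forall u v, beta u v = 0.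

Definition spin (a : nat) : CC := - (a%:R / 2).

(* Main.v *)
(** A block beta is determined by phi = beta(., e2 0), because e2 0 generates the
second module. The block conditions make phi vanish on the images of all but finitely
many lowering modes, so phi is determined by its values on the words
J^-_{n_1} ... J^-_{n_p} e1 0 (if s <= t) or J^+_{n_1} ... J^+_{n_p} e1 0 (if t < s),
and comparing the two actions of J^0_0 on such a word kills phi, except on the empty
word when i = j and s = t.

For i = j and s = t a nonzero block exists as soon as the second module carries a
functional that is 1 on e2 0 and factors through the character of the opposite Borel
subalgebra. Such a functional on U(g) can be written down without the PBW theorem: to
evaluate it on a word, apply the weight to the last letter if that letter lies in the
Borel subalgebra, and otherwise commute it to the left end, where it is killed; the
Jacobi identity shows that the result respects the relations of U(g). The universal
properties of the two induced modules then turn it into a block. *)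
Require Import Defs.
From HB Require Import structures.
From mathcomp Require Import all_boot all_order all_algebra.
From mathcomp Require Import ring zify boolp functions.
Import Order.TTheory GRing.Theory Num.Theory.
Local Open Scope ring_scope.
Set Implicit Arguments. Unset Strict Implicit. Unset Printing Implicit Defensive.

(** * Linear combinations and the bracket *)

(** A formal linear combination is a list of weighted terms. It is only used through its values on
    functions [G], so identities in the free module are stated by quantifying over [G]. *)
Definition lin {R : comNzRingType} {V : lmodType R} {X : Type} (L : seq (R * X)) (G : X -> V) : V :=
  \sum_(p <- L) p.1 *: G p.2.

Definition br {R : comNzRingType} (x y : gen) : seq (R * gen) :=
  match x, y with
  | GJp m, GJm n => [:: (1, GJ0 (m + n)); (m%:~R * (m + n == 0)%:R, GK)]
  | GJm n, GJp m => [:: (-1, GJ0 (m + n)); (- (m%:~R * (m + n == 0)%:R), GK)]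
  | GJ0 m, GJp n => [:: (2, GJp (m + n))]
  | GJp n, GJ0 m => [:: (- 2, GJp (m + n))]
  | GJ0 m, GJm n => [:: (- 2, GJm (m + n))]
  | GJm n, GJ0 m => [:: (2, GJm (m + n))]
  | GJ0 m, GJ0 n => [:: (2 * m%:~R * (m + n == 0)%:R, GK)]
  | Gd, GJp n => [:: (n%:~R, GJp n)]
  | Gd, GJm n => [:: (n%:~R, GJm n)]
  | Gd, GJ0 n => [:: (n%:~R, GJ0 n)]
  | GJp n, Gd => [:: (- n%:~R, GJp n)]
  | GJm n, Gd => [:: (- n%:~R, GJm n)]
  | GJ0 n, Gd => [:: (- n%:~R, GJ0 n)]
  | _, _ => [::]
  end.

Section Lin.
Variables (R : comNzRingType) (V : lmodType R) (X : Type).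
Implicit Types (L : seq (R * X)) (G H : X -> V).

Lemma lin_nil G : lin [::] G = 0.
Proof. exact: big_nil. Qed.

Lemma lin_cons p L G : lin (p :: L) G = p.1 *: G p.2 + lin L G.
Proof. exact: big_cons. Qed.

Lemma lin_cat L L' G : lin (L ++ L') G = lin L G + lin L' G.
Proof. exact: big_cat. Qed.

Lemma lin_map (Y : Type) (h : Y -> X) (L : seq (R * Y)) G :
  lin [seq (p.1, h p.2) | p <- L] G = lin L (fun y => G (h y)).
Proof. by rewrite /lin big_map. Qed.

Lemma lin_ext L G H : G =1 H -> lin L G = lin L H.
Proof. by move=> GH; apply: eq_bigr => p _; rewrite GH. Qed.

Lemma linD L G H : lin L (fun x => G x + H x) = lin L G + lin L H.
Proof. by rewrite /lin -big_split; apply: eq_bigr => p _; rewrite scalerDr. Qed.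

Lemma linN L G : lin L (fun x => - G x) = - lin L G.
Proof. by rewrite /lin -sumrN; apply: eq_bigr => p _; rewrite scalerN. Qed.

Lemma linB L G H : lin L (fun x => G x - H x) = lin L G - lin L H.
Proof. by rewrite linD linN. Qed.

Lemma linZ L c G : lin L (fun x => c *: G x) = c *: lin L G.
Proof.
by rewrite /lin scaler_sumr; apply: eq_bigr => p _; rewrite !scalerA mulrC.
Qed.

Lemma lin_const0 L : lin L (fun=> 0 : V) = 0.
Proof. by rewrite /lin big1 // => p _; rewrite scaler0. Qed.

Lemma lin_exchange (Y : Type) L (L' : seq (R * Y)) (H : X -> Y -> V) :
  lin L (fun x => lin L' (H x)) = lin L' (fun y => lin L (H ^~ y)).
Proof.
rewrite /lin; under eq_bigr do rewrite scaler_sumr.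
rewrite exchange_big; apply: eq_bigr => q _; rewrite scaler_sumr.
by apply: eq_bigr => p _; rewrite !scalerA mulrC.
Qed.

End Lin.

Lemma cocycle_anti (R : comNzRingType) (m n : int) :
  m%:~R * (m + n == 0)%:R = - (n%:~R * (n + m == 0)%:R) :> R.
Proof.
rewrite [n + m]addrC; case: eqP => [/eqP|_]; last by rewrite !mulr0 oppr0.
by rewrite addr_eq0 => /eqP ->; rewrite mulrNz !mulr1.
Qed.

Lemma lin_br_anti (R : comNzRingType) (V : lmodType R) x y (G : gen -> V) :
  lin (br x y) G = - lin (br y x) G.
Proof.
case: x => [m|m|m||]; case: y => [n|n|n||] /=;
  rewrite ?lin_cons ?lin_nil ?addr0 ?oppr0 //= ?scaleNr ?opprK ?opprD ?opprK //.
rewrite -scaleNr [n + m]addrC; congr (_ *: _).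
case: eqP => [/eqP|_]; last by rewrite !mulr0 oppr0.
by rewrite addr_eq0 => /eqP ->; rewrite rmorphN; ring.
Qed.

Lemma linC_cons (R : comNzRingType) (X : Type) p (L : seq (R * X)) (G : X -> R^o) :
  lin (p :: L) G = (p.1 * G p.2 + lin L G : R).
Proof. exact: big_cons. Qed.

Lemma linC_mull (R : comNzRingType) (X : Type) (L : seq (R * X)) (c : R) (G : X -> R^o) :
  lin L (fun x => c * G x : R^o) = (c * lin L G : R).
Proof. exact: (linZ L c G). Qed.

(** The Jacobi identity in the form $[x,[y,z]]+[[x,z],y]=[[x,y],z]$, the arrangement in which the
    terms appear in [vacf_comm]. *)
Lemma br_jacobi (R : comNzRingType) (x y z : gen) (G : gen -> R^o) :
  lin (br y z) (fun c => lin (br x c) G) + lin (br x z) (fun c => lin (br c y) G)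
  = lin (br x y) (fun c => lin (br c z) G) :> R.
Proof.
(* Nested brackets produce the sum of the three modes in many shapes; these equations bring them all
   to one. *)
have idx (m n p : int) :
  ((((m + (n + p))%R = (m + n + p)%R) * ((m + (p + n))%R = (m + n + p)%R) * ((n + (m + p))%R = (m + n + p)%R)) *
   (((n + (p + m))%R = (m + n + p)%R) * ((p + (m + n))%R = (m + n + p)%R) * ((p + (n + m))%R = (m + n + p)%R)) *
   (((m + p + n)%R = (m + n + p)%R) * ((n + m + p)%R = (m + n + p)%R) * ((n + p + m)%R = (m + n + p)%R)) *
   (((p + m + n)%R = (m + n + p)%R) * ((p + n + m)%R = (m + n + p)%R)))%type.
  by do !split; ring.
case: x => [m|m|m||]; case: y => [n|n|n||]; case: z => [p|p|p||] //=;
  rewrite !(linC_cons, lin_nil) /= ?(linC_cons, lin_nil) /= ?(mulr0, addr0, add0r) //.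
all: try rewrite ?(idx m n p).
all: try rewrite ?[n + m]addrC.
all: try rewrite ?[p + m]addrC.
all: try rewrite ?[p + n]addrC.
(* A central term survives only where the total mode is zero; one mode can then be eliminated. *)
all: try (case: (_ + _ =P 0) => [e|_]).
all: try (have -> : p = - (m + n) by rewrite -[RHS]addr0 -e; ring).
all: try (have -> : n = - m by rewrite -[RHS]addr0 -e; ring).
all: try (have -> : p = - m by rewrite -[RHS]addr0 -e; ring).
all: try (have -> : p = - n by rewrite -[RHS]addr0 -e; ring).
all: rewrite ?mulr1n ?mulr0n ?intrD ?mulrNz ?intrD.
all: ring.
Qed.

(** * The vacuum functional *)

Section VacuumFunctional.
Variables (R : comNzRingType) (X : Type) (bra : X -> X -> seq (R * X)).
Variables (neg npos : pred X) (lam : X -> R).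

Hypothesis bra_anti : forall x y (G : X -> R^o), lin (bra x y) G = - lin (bra y x) G.
Hypothesis bra_jacobi : forall x y z (G : X -> R^o),
  lin (bra y z) (fun c => lin (bra x c) G) + lin (bra x z) (fun c => lin (bra c y) G)
  = lin (bra x y) (fun c => lin (bra c z) G) :> R.
Hypothesis neg_npos : forall x, neg x -> npos x.
Hypothesis lam_neg : forall x, neg x -> lam x = 0.
(** The span of [neg] is an ideal in that of [npos], expressed through functionals vanishing on
    [neg]. *)
Hypothesis bra_npos_neg : forall x y (G : X -> R^o), npos x -> neg y ->
  (forall z, neg z -> G z = 0) -> lin (bra x y) G = 0.
(** The letters outside [neg] span a subalgebra, and [lam] is a character of it: it vanishes on
    brackets. *)
Hypothesis bra_nneg : forall x y (G : X -> R^o) (c : R), ~~ neg x -> ~~ neg y ->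
  (forall z, ~~ neg z -> G z = lam z * c) -> lin (bra x y) G = 0.

(* A word [:: x_n; ...; x_1] stands for the product x_1 ... x_n; [rad w y] is
   the commutator of that product with y. *)
Fixpoint rad (w : seq X) (y : X) : seq (R * seq X) :=
  if w is x :: w' then
    [seq (p.1, p.2 :: w') | p <- bra x y] ++ [seq (p.1, x :: p.2) | p <- rad w' y]
  else [::].

Lemma lin_rad_cons x w y (G : seq X -> R^o) :
  lin (rad (x :: w) y) G =
  lin (bra x y) (fun z => G (z :: w)) + lin (rad w y) (fun v => G (x :: v)).
Proof. by rewrite /= lin_cat (lin_map (cons^~ w)) (lin_map (cons x)). Qed.

Lemma lin_rad_cat u v y (G : seq X -> R^o) :
  lin (rad (u ++ v) y) G =
  lin (rad u y) (fun u' => G (u' ++ v)) + lin (rad v y) (fun v' => G (u ++ v')).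
Proof.
elim: u G => [|x u IH] G; first by rewrite lin_nil add0r.
by rewrite cat_cons !lin_rad_cons IH addrA.
Qed.

Lemma eq_lin_rad w y (G H : seq X -> R^o) :
  (forall v, size v = size w -> G v = H v) -> lin (rad w y) G = lin (rad w y) H.
Proof.
elim: w G H => [|x w IH] G H GH; first by rewrite !lin_nil.
rewrite !lin_rad_cons; congr (_ + _); first by apply: lin_ext => z; apply: GH.
by apply: IH => v sv; apply: GH; rewrite /= sv.
Qed.

(** This is $[[w,x],y]-[[w,y],x]=[w,[x,y]]$ for a product $w$. Bracketing is a derivation: the terms
    where $x$ and $y$ hit different letters cancel, and on a single letter the Jacobi identity
    applies. *)
Lemma lin_rad_comm w x y (G : seq X -> R^o) :
  lin (rad w x) (fun v => lin (rad v y) G) - lin (rad w y) (fun v => lin (rad v x) G)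
  = lin (bra x y) (fun z => lin (rad w z) G) :> R.
Proof.
elim: w G => [|a w IH] G.
  by rewrite !lin_nil subr0; under lin_ext do rewrite lin_nil; rewrite lin_const0.
have cons_head (L : seq (R * X)) t :
    lin L (fun z => lin (rad (z :: w) t) G) =
    lin L (fun z => lin (bra z t) (fun c => G (c :: w))) +
    lin L (fun z => lin (rad w t) (fun v => G (z :: v))).
  by rewrite -linD; apply: lin_ext => z; rewrite lin_rad_cons.
have cons_tail (L : seq (R * seq X)) t :
    lin L (fun v => lin (rad (a :: v) t) G) =
    lin L (fun v => lin (bra a t) (fun c => G (c :: v))) +
    lin L (fun v => lin (rad v t) (fun u => G (a :: u))).
  by rewrite -linD; apply: lin_ext => z; rewrite lin_rad_cons.
have -> : lin (bra x y) (fun z => lin (rad (a :: w) z) G) =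
    lin (bra x y) (fun z => lin (bra a z) (fun c => G (c :: w))) +
    lin (bra x y) (fun z => lin (rad w z) (fun v => G (a :: v))).
  by rewrite -linD; apply: lin_ext => z; rewrite lin_rad_cons.
rewrite !lin_rad_cons !cons_head !cons_tail -(IH (fun v => G (a :: v))).
rewrite (lin_exchange (rad w x)) (lin_exchange (rad w y)).
by rewrite -(bra_jacobi a x y (fun c => G (c :: w))) ; ring.
Qed.

(** Commuting the last letter through the others gives words of the length of the remainder, so the
    length of the word is enough fuel. *)
Fixpoint vacf_rec (n : nat) (w : seq X) : R^o :=
  if n is n'.+1 then
    if w is y :: w' then
      if neg y then lin (rad w' y) (vacf_rec n') else lam y * vacf_rec n' w'
    else 1
  else 1.

Definition vacf (w : seq X) : R^o := vacf_rec (size w) w.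

Lemma vacf_nil : vacf [::] = 1.
Proof. by []. Qed.

Lemma vacf_cons y w :
  vacf (y :: w) = if neg y then lin (rad w y) vacf else lam y * vacf w.
Proof.
rewrite /vacf /=; case: ifP => // _.
by apply: eq_lin_rad => v ->.
Qed.

(** Compatibility with the relations of the enveloping algebra, since words are read backwards. The
    induction is on the number of letters other than $x$ and $y$. *)
Lemma vacf_comm w' x y w :
  vacf (w' ++ y :: x :: w) - vacf (w' ++ x :: y :: w) =
  lin (bra x y) (fun z => vacf (w' ++ z :: w)) :> R.
Proof.
have [n] := ubnP (size w' + size w); elim: n => // n IH in w' x y w *.
case: w' => [_|t w' /= sz] /=.
  (* Here $x$ and $y$ are the last two letters. If both are in [neg], the claim is [lin_rad_comm];
     if one is, the Leibniz rule suffices; if none is, both words have value $\lambda(x)\lambda(y)$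
     times that of $w$. *)
  rewrite !vacf_cons; case: ifP => ny; case: ifP => nx.
  - rewrite !lin_rad_cons.
    under [X in _ + X - _]lin_ext => v do rewrite vacf_cons nx.
    under [X in _ - (_ + X)]lin_ext => v do rewrite vacf_cons ny.
    rewrite (bra_anti y x) opprD opprK.
    have -> : lin (bra x y) (fun z => vacf (z :: w)) =
              lin (bra x y) (fun z => lin (rad w z) vacf).
      apply/eqP; rewrite -subr_eq0 -linB; apply/eqP.
      apply: bra_npos_neg ny _; first exact: neg_npos.
      by move=> z nz; rewrite vacf_cons nz subrr.
    by rewrite -lin_rad_comm; ring.
  - rewrite lin_rad_cons; under [X in _ + X - _]lin_ext => v do rewrite vacf_cons nx.
    by rewrite linC_mull; ring.
  - rewrite lin_rad_cons.
    under [X in _ - (_ + X)]lin_ext => v do rewrite vacf_cons ny.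
    by rewrite linC_mull (bra_anti x y); ring.
  - rewrite (@bra_nneg _ _ _ (vacf w)) ?nx ?ny //; first by ring.
    by move=> z nz; rewrite vacf_cons (negbTE nz).
(* The last letter $t$ is now away from the pair. Outside [neg] it contributes a scalar; in [neg] it
   is bracketed with every letter in turn. *)
rewrite !vacf_cons; case: ifP => nt; last first.
  have -> : lin (bra x y) (fun z => vacf (t :: w' ++ z :: w)) =
            lin (bra x y) (fun z => lam t * vacf (w' ++ z :: w) : R^o).
    by apply: lin_ext => z; rewrite vacf_cons nt.
  by rewrite linC_mull -mulrBr IH.
have -> : lin (bra x y) (fun z => vacf (t :: w' ++ z :: w)) =
  lin (bra x y) (fun z => lin (rad (w' ++ z :: w) t) vacf).
  by apply: lin_ext => z; rewrite vacf_cons nt.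
have expand u a b v : lin (rad (u ++ a :: b :: v) t) vacf =
    lin (rad u t) (fun u' => vacf (u' ++ a :: b :: v)) +
    (lin (bra a t) (fun c => vacf (u ++ c :: b :: v)) +
    (lin (bra b t) (fun c => vacf (u ++ a :: c :: v)) +
     lin (rad v t) (fun v' => vacf (u ++ a :: b :: v')))).
  by rewrite lin_rad_cat !lin_rad_cons.
have -> : lin (bra x y) (fun z => lin (rad (w' ++ z :: w) t) vacf) =
    lin (bra x y) (fun z => lin (rad w' t) (fun u => vacf (u ++ z :: w))) +
    (lin (bra x y) (fun z => lin (bra z t) (fun c => vacf (w' ++ c :: w))) +
     lin (bra x y) (fun z => lin (rad w t) (fun u => vacf (w' ++ z :: u)))).
  by rewrite -!linD; apply: lin_ext => z; rewrite lin_rad_cat lin_rad_cons.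
rewrite !expand.
have left_part :
    lin (rad w' t) (fun u => vacf (u ++ y :: x :: w)) -
    lin (rad w' t) (fun u => vacf (u ++ x :: y :: w)) =
    lin (bra x y) (fun z => lin (rad w' t) (fun u => vacf (u ++ z :: w))) :> R.
  rewrite -linB lin_exchange; apply: eq_lin_rad => u su.
  by apply: IH; rewrite su.
have right_part :
    lin (rad w t) (fun u => vacf (w' ++ y :: x :: u)) -
    lin (rad w t) (fun u => vacf (w' ++ x :: y :: u)) =
    lin (bra x y) (fun z => lin (rad w t) (fun u => vacf (w' ++ z :: u))) :> R.
  rewrite -linB lin_exchange; apply: eq_lin_rad => u su.
  by apply: IH; rewrite su.
have mid_y : lin (bra y t) (fun c => vacf (w' ++ c :: x :: w)) -
    lin (bra y t) (fun c => vacf (w' ++ x :: c :: w)) =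
    lin (bra y t) (fun c => lin (bra x c) (fun z => vacf (w' ++ z :: w))) :> R.
  by rewrite -linB; apply: (@lin_ext R R^o) => c; apply: IH.
have mid_x : lin (bra x t) (fun c => vacf (w' ++ y :: c :: w)) -
    lin (bra x t) (fun c => vacf (w' ++ c :: y :: w)) =
    lin (bra x t) (fun c => lin (bra c y) (fun z => vacf (w' ++ z :: w))) :> R.
  by rewrite -linB; apply: (@lin_ext R R^o) => c; apply: IH.
(* Brackets of $t$ with the outer letters are settled by induction; those with $x$ and $y$ combine
   by the Jacobi identity. *)
rewrite -(bra_jacobi x y t (fun c => vacf (w' ++ c :: w))).
by rewrite -mid_y -mid_x -left_part -right_part; ring.
Qed.

(** The added letter is leftmost in the product. When a last letter $t$ in [neg] is commuted left,
    its bracket with $x$ lies in the ideal [neg] and contributes zero by induction. *)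
Lemma vacf_rcons w x : npos x -> vacf (rcons w x) = lam x * vacf w :> R.
Proof.
have [n] := ubnP (size w); elim: n => // n IH in w x *.
case: w => [_|t w /= sz] nx.
  rewrite /= vacf_cons vacf_nil; case: ifP => [/lam_neg -> |//].
  by rewrite mul0r lin_nil.
rewrite !vacf_cons; case: ifP => nt; last by rewrite IH // mulrCA.
rewrite -cats1 lin_rad_cat lin_rad_cons [lin (rad [::] _) _]lin_nil addr0.
rewrite (bra_npos_neg nx nt) => [|z nz].
  rewrite addr0 -linC_mull; apply: (@eq_lin_rad _ _ _ (fun v => _ : R^o)) => v sv.
  by rewrite cats1 IH // sv.
by rewrite cats1 IH ?neg_npos // lam_neg // mul0r.
Qed.

End VacuumFunctional.

(** * Subspaces as modules *)

Definition subspace (W : lmodType CC) (P : W -> Prop) : Prop :=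
  P 0 /\ forall (c : CC) u v, P u -> P v -> P (c *: u + v).

Section Subspace.
Variables (W : lmodType CC) (P : W -> Prop).

(** Taking the proof as an argument lets canonical inference find the closure instance declared
    below. *)
Definition subspace_pred (sP : subspace P) : {pred W} := fun v => `[< P v >].

Variable sP : subspace P.

Lemma subspace_pred_closed : submod_closed (subspace_pred sP).
Proof.
split=> [|c u v]; first by apply/asboolP; case: sP.
by move=> /asboolP Pu /asboolP Pv; apply/asboolP; apply: sP.2.
Qed.

HB.instance Definition _ :=
  GRing.isSubmodClosed.Build CC W (subspace_pred sP) subspace_pred_closed.

Record subspace_type := SubspaceType { sub_val : W; _ : sub_val \in subspace_pred sP }.

HB.instance Definition _ := [isSub for sub_val].
HB.instance Definition _ := [Choice of subspace_type by <:].
HB.instance Definition _ := [SubChoice_isSubLmodule of subspace_type by <:].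
End Subspace.

Section SubspaceTheory.
Variables (W : lmodType CC) (P : W -> Prop).

Lemma subspace0 : subspace P -> P 0. Proof. by case. Qed.

Lemma subspaceD u v : subspace P -> P u -> P v -> P (u + v).
Proof. by case=> _ h Pu Pv; rewrite -[u]scale1r; apply: h. Qed.

Lemma subspaceZ c u : subspace P -> P u -> P (c *: u).
Proof. by case=> P0 h Pu; rewrite -[_ *: _]addr0; apply: h. Qed.

Lemma subspaceN u : subspace P -> P u -> P (- u).
Proof. by move=> sP Pu; rewrite -scaleN1r; apply: subspaceZ. Qed.

Lemma subspace_val (sP : subspace P) (u : subspace_type sP) : P (val u).
Proof. by case: u => u /= /asboolP. Qed.

End SubspaceTheory.

(** One uniform commutation rule replaces the list of relations, so that later arguments need no
    case analysis on generators. *)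
Lemma hsl2_repP (V : lmodType CC) (rho : gen -> V -> V) :
  hsl2_rep rho <->
  (forall x (c : CC) u v, rho x (c *: u + v) = c *: rho x u + rho x v) /\
  forall x y v, comm rho x y v = lin (br x y) (rho ^~ v).
Proof.
split=> [[lin_rho [[pm zp zm zz] [[pp mm dp dm dz] k_x]]]|[lin_rho h]]; last first.
  split=> //; split; [split|split; [split|]] => *; rewrite h /=;
    by rewrite ?lin_cons ?lin_nil ?addr0 ?scale1r ?scaleNr.
split=> // x y v.
have comm_anti a b : comm rho a b v = - comm rho b a v by rewrite /comm opprB.
have comm_self a : comm rho a a v = 0 by rewrite /comm subrr.
have x_k a : comm rho a GK v = 0 by rewrite comm_anti k_x oppr0.
case: x => [m|m|m||]; case: y => [n|n|n||]; rewrite ?k_x ?x_k ?comm_self ?pp ?mm //=.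
all: rewrite ?lin_cons ?lin_nil ?addr0 /= ?scale1r ?scaleNr //.
all: rewrite ?pm ?zp ?zm ?zz ?dp ?dm ?dz ?scale1r //.
all: by rewrite comm_anti ?pm ?zp ?zm ?dp ?dm ?dz ?opprD ?opprK ?scale1r.
Qed.

(** * Maps out of prolongations *)

(** Relativised to [P] because the operators used below act on full function spaces but satisfy the
    relations only on a subspace. *)
Definition rep_on (W : lmodType CC) (P : W -> Prop) (sigma : gen -> W -> W) : Prop :=
  [/\ subspace P,
      forall x (c : CC) u v, P u -> P v -> sigma x (c *: u + v) = c *: sigma x u + sigma x v,
      forall x v, P v -> P (sigma x v) &
      forall x y v, P v -> comm sigma x y v = lin (br x y) (sigma ^~ v)].

Lemma hsl2_rep_on (V : lmodType CC) (rho : gen -> V -> V) (P : V -> Prop) :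
  hsl2_rep rho -> subspace P -> (forall x v, P v -> P (rho x v)) -> rep_on P rho.
Proof. by move=> /hsl2_repP [lin_rho h] sP stP; split=> // *; apply: h. Qed.

Section RepOn.
Variables (W : lmodType CC) (P : W -> Prop) (sigma : gen -> W -> W).
Hypothesis rP : rep_on P sigma.

Lemma rep_onD x u v : P u -> P v -> sigma x (u + v) = sigma x u + sigma x v.
Proof. by case: rP => _ h _ _ Pu Pv; rewrite -[u]scale1r h // !scale1r. Qed.

Lemma rep_on0 x : sigma x 0 = 0.
Proof.
have P0 : P 0 by case: rP => /subspace0.
by apply: (@addrI _ (sigma x 0)); rewrite -rep_onD // !addr0.
Qed.

Lemma rep_onZ x c u : P u -> sigma x (c *: u) = c *: sigma x u.
Proof.
case: rP => sP h _ _ Pu; rewrite -[c *: u]addr0 h ?rep_on0 ?addr0 //.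
exact: subspace0 sP.
Qed.

Lemma rep_onN x u : P u -> sigma x (- u) = - sigma x u.
Proof. by move=> Pu; rewrite -scaleN1r rep_onZ // scaleN1r. Qed.

Lemma rep_on_swap x y v : P v ->
  sigma x (sigma y v) = sigma y (sigma x v) + lin (br x y) (sigma ^~ v).
Proof. by case: rP => _ _ _ h Pv; rewrite -h // /comm addrC subrK. Qed.

End RepOn.

(** The universal property is applied to [P], made into a module of its own; composing with the
    inclusion gives a map with values in [P]. *)
Lemma prolongation_map (eps : bool) (j : CC) (k : int)
    (V : lmodType CC) (rho : gen -> V -> V) (e : nat -> V)
    (W : lmodType CC) (P : W -> Prop) (sigma : gen -> W -> W) (f : nat -> W) :
  is_prolongation eps j k rho e -> rep_on P sigma -> (forall m, P (f m)) ->
  prol_rel eps j k sigma f ->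
  exists g : V -> W,
    [/\ forall (c : CC) u v, g (c *: u + v) = c *: g u + g v,
        forall x v, g (rho x v) = sigma x (g v),
        forall m, g (e m) = f m &
        forall v, P (g v)].
Proof.
move=> [_ _ univ] rP Pf relf; have [sP lin_s st_s comm_s] := rP.
pose mk v (Pv : P v) : subspace_type sP :=
  SubspaceType (introT (asboolP _) Pv : v \in subspace_pred sP).
pose sU x (u : subspace_type sP) := mk _ (st_s x _ (subspace_val u)).
pose fU m := mk _ (Pf m).
have valD (u v : subspace_type sP) : val (u + v) = val u + val v := raddfD _ u v.
have valZ c (u : subspace_type sP) : val (c *: u) = c *: val u := linearZ _ u.
have valN (u : subspace_type sP) : val (- u) = - val u := raddfN _ u.
have val_inj' (u v : subspace_type sP) : val u = val v -> u = v by apply: val_inj.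
have val0 : val (0 : subspace_type sP) = 0 := raddf0 _.
have val_s x u : val (sU x u) = sigma x (val u) by [].
have val_f m : val (fU m) = f m by [].
have rU : hsl2_rep sU.
  apply/hsl2_repP; split=> [x c u v|x y v]; apply: val_inj'.
    by rewrite !(valD, valZ, val_s) lin_s //; apply: subspace_val.
  rewrite /comm valD valN !val_s [LHS](comm_s x y _ (subspace_val v)).
  elim: (br x y) => [|p L IH]; first by rewrite !lin_nil.
  by rewrite !lin_cons valD valZ val_s IH.
have relU : prol_rel eps j k sU fU.
  case: relf => r1 r2 r3 r4; split=> [|m|n m n_gt0|m]; first last.
  - by apply: val_inj'; rewrite valZ val_s val_f r4.
  - by have [h1 h2 h3] := r3 n m n_gt0; split; apply: val_inj'; rewrite val0 val_s val_f.
  - by apply: val_inj'; rewrite valZ val_s val_f r2.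
  - case: eps r1 {univ} => -[h1 h2 h3]; split=> m; apply: val_inj';
      by rewrite val_s !val_f ?h1 ?h2 ?h3 ?valN valZ val_f.
have [[g [lin_g int_g g_e]] _] := univ _ sU fU rU relU.
exists (fun v => val (g v)); split=> [c u v|x v|m|v].
- by rewrite lin_g valD valZ.
- by rewrite int_g.
- by rewrite g_e.
- exact: subspace_val.
Qed.

Lemma subr_2spin (a : nat) (x : CC) : x - 2 * spin a = x + a%:R.
Proof. by rewrite /spin mulrN opprK mulrCA divff ?mulr1 // pnatr_eq0. Qed.

Lemma double_spin (a : nat) : 2 * spin a = - a%:R.
Proof. by have := subr_2spin a 0; rewrite sub0r add0r => <-; rewrite opprK. Qed.

Lemma sqrtC_ladder_neq0 (a m : nat) : (0 < a)%N ->
  sqrtC (m.+1%:R * (m%:R - 2 * spin a)) != 0 :> CC.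
Proof.
move=> a_gt0; rewrite sqrtC_eq0 subr_2spin -natrD mulf_neq0 ?pnatr_eq0 //.
by rewrite addn_eq0 negb_and -!lt0n a_gt0 orbT.
Qed.

(** * Induction principles for prolongations *)

Section Generation.
Variables (eps : bool) (a : nat) (k : int).
Variables (V : lmodType CC) (rho : gen -> V -> V) (e : nat -> V).
Hypotheses (a_gt0 : (0 < a)%N) (prol : is_prolongation eps (spin a) k rho e).

Lemma ladder_ind (P : V -> Prop) : subspace P -> P (e 0%N) ->
  (forall v, P v -> P (rho (GJp 0) v) /\ P (rho (GJm 0) v)) -> forall m, P (e m).
Proof.
move=> sP P0 st; have [_ [rel _ _ _] _] := prol; elim=> [//|m IH].
suff : P (sqrtC (m.+1%:R * (m%:R - 2 * spin a)) *: e m.+1).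
  move/(subspaceZ (sqrtC (m.+1%:R * (m%:R - 2 * spin a)))^-1 sP).
  by rewrite scalerA mulVf ?sqrtC_ladder_neq0 // scale1r.
have [Pp Pm] := st _ IH.
by case: (eps) rel => -[_ h h']; rewrite -?h -?h'.
Qed.

(** The universal map into the submodule [P], followed by the inclusion, equals the identity by
    uniqueness, so every vector lies in [P]. *)
Lemma prolongation_ind_gen (P : V -> Prop) : subspace P -> P (e 0%N) ->
  (forall x v, P v -> P (rho x v)) -> forall v, P v.
Proof.
move=> sP P0 st; have [rep rel univ] := prol.
have Pe : forall m, P (e m) by apply: ladder_ind => // v Pv; split; apply: st.
have [g [lin_g int_g g_e Pg]] := prolongation_map prol (hsl2_rep_on rep sP st) Pe rel.
move=> v; have [_ /(_ g id)] := univ V rho e rep rel.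
by move/(_ lin_g int_g g_e (fun _ _ _ => erefl) (fun _ _ => erefl) (fun=> erefl) v) => <-.
Qed.

Lemma prolongation_K v : rho GK v = k%:~R *: v.
Proof.
have [rep [_ relK _ _] _] := prol; have [lin_rho comm_rho] := (hsl2_repP rho).1 rep.
have rT : rep_on (fun=> True) rho by apply: hsl2_rep_on.
move: v; apply: prolongation_ind_gen => [|//|x v Kv].
  split=> [|c u v Ku Kv]; first by rewrite (rep_on0 rT) scaler0.
  by rewrite lin_rho Ku Kv scalerDr !scalerA mulrC.
have := comm_rho GK x v; rewrite /comm => /eqP; rewrite subr_eq => /eqP ->.
by rewrite Kv /br lin_nil add0r (rep_onZ rT).
Qed.

(* d maps the smallest J-stable subspace containing e 0 into itself, so stability
   under d need not be assumed. *)
Lemma prolongation_ind (P : V -> Prop) : subspace P -> P (e 0%N) ->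
  (forall n v, P v -> [/\ P (rho (GJp n) v), P (rho (GJm n) v) & P (rho (GJ0 n) v)]) ->
  forall v, P v.
Proof.
move=> sP P0 stP v.
pose stJ (Q : V -> Prop) := forall n v, Q v ->
  [/\ Q (rho (GJp n) v), Q (rho (GJm n) v) & Q (rho (GJ0 n) v)].
pose S v := forall Q, subspace Q -> Q (e 0%N) -> stJ Q -> Q v.
have sS : subspace S.
  split=> [Q [] //|c u w Su Sw Q sQ Q0 stQ].
  by apply: sQ.2; [apply: Su|apply: Sw].
have S0 : S (e 0%N) by move=> Q _.
have stS : stJ S.
  by move=> n u Su; split=> Q sQ Q0 stQ; have [] := stQ n u (Su Q sQ Q0 stQ).
suff: S v by apply.
have [rep [_ _ _ reld] _] := prol.
have rS : rep_on (fun=> True) rho by apply: hsl2_rep_on.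
have Sd u : S u -> S (rho Gd u).
  move=> Su; suff [] : S u /\ S (rho Gd u) by [].
  apply: (Su (fun u => S u /\ S (rho Gd u))).
  - split; first by rewrite (rep_on0 rS); split; apply: (subspace0 sS).
    move=> c u1 u2 [h1 h2] [h3 h4]; split; first exact: sS.2.
    by case: rep => -> _; apply: sS.2.
  - by split=> //; rewrite reld; apply: (subspaceZ _ sS).
  - move=> n w [Sw Sdw]; have [h1 h2 h3] := stS n _ Sw; have [h4 h5 h6] := stS n _ Sdw.
    split; split=> //; rewrite (rep_on_swap rS Gd) //= lin_cons lin_nil addr0;
      by apply: (subspaceD sS) => //; apply: (subspaceZ _ sS).
move: v; apply: prolongation_ind_gen => // -[n|n|n||] u Su; try by have [] := stS n _ Su.
- by rewrite prolongation_K; apply: (subspaceZ _ sS).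
- exact: Sd.
Qed.

End Generation.

(** * Highest weight vectors *)

(** The twist by the involution exchanging $J^+$ and $J^-$. It exchanges $D^+_j$ with $D^-_j$, so
    one sign can be deduced from the other. *)
Definition flip (W : lmodType CC) (sigma : gen -> W -> W) : gen -> W -> W :=
  fun x v => match x with
  | GJp n => sigma (GJm n) v
  | GJm n => sigma (GJp n) v
  | GJ0 n => - sigma (GJ0 n) v
  | GK => sigma GK v
  | Gd => sigma Gd v
  end.

Lemma rep_on_flip (W : lmodType CC) (P : W -> Prop) (sigma : gen -> W -> W) :
  rep_on P sigma -> rep_on P (flip sigma).
Proof.
move=> rP; have [sP lin_s st_s comm_s] := rP; split=> //.
- by move=> [n|n|n||] c u v Pu Pv /=; rewrite lin_s // opprD scalerN.
- by move=> [n|n|n||] v Pv /=; try exact: st_s; apply: (subspaceN sP); apply: st_s.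
move=> x y v Pv; pose tw z := match z with GJp n => GJm n | GJm n => GJp n | _ => z end.
pose sg z : CC := if z is GJ0 _ then -1 else 1.
have flipE z u : flip sigma z u = sg z *: sigma (tw z) u.
  by case: z => *; rewrite /= ?scale1r ?scaleN1r.
have [Px Py] : P (sigma (tw x) v) /\ P (sigma (tw y) v) by split; apply: st_s.
rewrite /comm !flipE !(rep_onZ rP) // !scalerA [sg y * _]mulrC.
rewrite -scalerBr -/(comm sigma _ _ _) comm_s // => {Px Py}.
case: x => [m|m|m||]; case: y => [n|n|n||];
  rewrite /= ?lin_cons ?lin_nil ?scaler0 ?addr0 //= ?mul1r ?mulr1 ?scale1r //.
all: rewrite ?scaleN1r ?scaleNr ?scalerN ?opprK ?mulrNN ?mulr1 ?scale1r //.
all: by rewrite (cocycle_anti _ m n) scaleNr [m + n]addrC.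
Qed.

Lemma prol_rel_flip (W : lmodType CC) (eps : bool) (j : CC) (k : int)
    (sigma : gen -> W -> W) (f : nat -> W) :
  prol_rel eps j k (flip sigma) f -> prol_rel (~~ eps) j k sigma f.
Proof.
case=> rel relK rel0 reld; split=> // [|n m n_gt0]; last first.
  have [h1 h2 /= h3] := rel0 n m n_gt0; split=> //.
  by apply: oppr_inj; rewrite h3 oppr0.
case: eps rel => -[/= h1 h2 h3]; split=> // m;
  by apply: oppr_inj; rewrite h1 -scaleNr -mulrN opprB.
Qed.

(** The conditions satisfied by $|j,0\rangle_+$; the Borel subalgebra meant here contains $J^-_0$,
    not $J^+_0$. *)
Definition hw_vector (W : lmodType CC) (j : CC) (k : int)
    (sigma : gen -> W -> W) (f : W) : Prop :=
  [/\ sigma (GJ0 0) f = (- (2 * j)) *: f, sigma (GJm 0) f = 0,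
      sigma GK f = k%:~R *: f,
      sigma Gd f = (- (j * (j + 1)) / (k%:~R + 2)) *: f &
      forall n : int, 0 < n ->
        [/\ sigma (GJp n) f = 0, sigma (GJm n) f = 0 & sigma (GJ0 n) f = 0]].

(** One such vector suffices to map out of the prolongation: its normalised images under powers of
    $J^+_0$ obey all the formulas of $D^+_j$. *)
Lemma hw_vector_prol_rel (W : lmodType CC) (P : W -> Prop) (a : nat) (k : int)
    (sigma : gen -> W -> W) (f0 : W) :
  (0 < a)%N -> rep_on P sigma -> P f0 -> hw_vector (spin a) k sigma f0 ->
  exists f, [/\ f 0%N = f0, forall m, P (f m) & prol_rel true (spin a) k sigma f].
Proof.
move=> a_gt0 rP Pf0 [h_0 h_m h_K h_d h_pos]; have [sP _ st_s _] := rP.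
pose c (m : nat) : CC := sqrtC (m.+1%:R * (m%:R - 2 * spin a)).
have c_neq0 m : c m != 0 by apply: sqrtC_ladder_neq0.
have c_sq m : c m * c m = m.+1%:R * (m%:R + a%:R) by rewrite -expr2 sqrtCK subr_2spin.
pose f := fix f m := if m is m'.+1 then (c m')^-1 *: sigma (GJp 0) (f m') else f0.
have f0E : f 0%N = f0 by rewrite /f.
have Pf m : P (f m).
  by elim: m => [//|m IH] /=; apply: (subspaceZ _ sP); apply: st_s.
have f_p m : sigma (GJp 0) (f m) = c m *: f m.+1.
  by rewrite /= scalerA mulfV // scale1r.
have f_S x m : sigma x (f m.+1) =
    (c m)^-1 *: (sigma (GJp 0) (sigma x (f m)) + lin (br x (GJp 0)) (sigma ^~ (f m))).
  by rewrite -(rep_on_swap rP) // -(rep_onZ rP); [|exact: st_s].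
clearbody f.
have f_0 m : sigma (GJ0 0) (f m) = (2 * (m%:R - spin a)) *: f m.
  elim: m => [|m IH]; first by rewrite f0E h_0 mulr0n sub0r [in RHS]mulrN.
  rewrite f_S IH (rep_onZ rP) // /= lin_cons lin_nil !addr0 /= f_p -scalerDl !scalerA.
  rewrite [_ * c m]mulrC mulVKf // -(natr1 m); congr (_ *: _).
  have ringE (R : comNzRingType) (x y : R) : 2 * (x - y) + 2 = 2 * (x + 1 - y) by ring.
  exact: ringE.
(* From $J^-J^+=J^+J^--J^0$, the induction reduces to $m(m-1+a)+(2m+a)=(m+1)(m+a)$. *)
have f_m m : sigma (GJm 0) (f m) = - (sqrtC (m%:R * (m%:R - 1 - 2 * spin a)) *: f m.-1).
  elim: m => [|m IH]; first by rewrite f0E h_m mul0r sqrtC0 scale0r oppr0.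
  have -> : sqrtC (m.+1%:R * (m.+1%:R - 1 - 2 * spin a)) = c m :> CC.
    by rewrite /c -[in X in _ * (X - _ - _)]natr1 addrK.
  rewrite f_S; have -> : sigma (GJp 0) (sigma (GJm 0) (f m)) = - (m%:R * (m%:R - 1 + a%:R)) *: f m.
    case: m IH => [|m] ->.
      by rewrite mul0r sqrtC0 scale0r !oppr0 mul0r oppr0 scale0r (rep_on0 rP).
    rewrite (rep_onN rP) ?(rep_onZ rP) //; last exact: (subspaceZ _ sP).
    have -> : sqrtC (m.+1%:R * (m.+1%:R - 1 - 2 * spin a)) = c m :> CC.
      by rewrite /c -[in X in _ * (X - _ - _)]natr1 addrK.
    by rewrite f_p scalerA c_sq -[in RHS](natr1 m) addrK (natr1 m) scaleNr.
  rewrite /= !lin_cons lin_nil /= mul0r oppr0 scale0r !addr0 f_0 scalerA -scalerDl scalerA.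
  rewrite -scaleNr; congr (_ *: _); apply: (mulfI (c_neq0 m)).
  rewrite mulrA mulfV // mul1r mulrN c_sq -(natr1 m) mulrBr double_spin.
  have ringE (R : comNzRingType) (x y : R) :
    - (x * (x - 1 + y)) + -1 * (2 * x - - y) = - ((x + 1) * (x + y)) by ring.
  exact: ringE.
have f_K m : sigma GK (f m) = k%:~R *: f m.
  elim: m => [|m IH]; first by rewrite f0E.
  by rewrite f_S IH (rep_onZ rP) // lin_nil addr0 f_p !scalerA [_ * c m]mulrC mulVKf.
have f_d m : sigma Gd (f m) = (- (spin a * (spin a + 1)) / (k%:~R + 2)) *: f m.
  elim: m => [|m IH]; first by rewrite f0E.
  rewrite f_S IH (rep_onZ rP) // lin_cons lin_nil /= scale0r !addr0.
  by rewrite f_p !scalerA [_ * c m]mulrC mulVKf.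
exists f; split=> //; split=> // n m n_gt0.
elim: m => [|m [IH1 IH2 IH3]]; first by rewrite f0E; apply: h_pos.
rewrite !f_S IH1 IH2 IH3 !(rep_on0 rP) /= !lin_cons !lin_nil /=.
by rewrite !(mul0r, oppr0, scale0r, addr0, add0r) IH1 IH3 !scaler0.
Qed.

(** * Existence of a block *)

(* For the Borel subalgebra fixing the line of |j,0>_-: gneg is n_-, gnpos is h + n_-. *)
Definition gneg (x : gen) : bool :=
  match x with GJp n => n < 0 | GJm n => n <= 0 | GJ0 n => n < 0 | _ => false end.

Definition gnpos (x : gen) : bool :=
  match x with GJp n => n < 0 | GJm n => n <= 0 | GJ0 n => n <= 0 | _ => true end.

Definition hw_weight (j : CC) (k : int) (x : gen) : CC :=
  match x with
  | GJ0 n => if n == 0 then 2 * j else 0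
  | GK => k%:~R
  | Gd => - (j * (j + 1)) / (k%:~R + 2)
  | _ => 0
  end.

Lemma gneg_npos x : gneg x -> gnpos x.
Proof. by case: x => //= n /ltW. Qed.

Lemma hw_weight_neg j k x : gneg x -> hw_weight j k x = 0.
Proof. by case: x => //= n n_lt0; rewrite lt_eqF. Qed.

Lemma br_npos_neg x y (G : gen -> CC^o) : gnpos x -> gneg y ->
  (forall z, gneg z -> G z = 0) -> lin (br x y) G = 0.
Proof.
case: x => [m|m|m||]; case: y => [n|n|n||] //= nx ny G0;
  rewrite ?lin_cons ?lin_nil ?addr0 //=
    ?(G0 (GJp _)) ?(G0 (GJm _)) ?(G0 (GJ0 _)) /= ?scaler0 ?add0r //; try by lia.
all: by rewrite [_ == 0](_ : _ = false) ?(mulr0, oppr0, scale0r) //; lia.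
Qed.

(** The weight is a character of the Borel subalgebra: there a bracket of generators contains
    $J^0_0$, $K$ or $d$ only with coefficient zero. *)
Lemma br_nneg j k x y (G : gen -> CC^o) (c : CC) : ~~ gneg x -> ~~ gneg y ->
  (forall z, ~~ gneg z -> G z = hw_weight j k z * c) -> lin (br x y) G = 0.
Proof.
case: x => [m|m|m||]; case: y => [n|n|n||] //= nx ny G0;
  rewrite ?lin_cons ?lin_nil ?addr0 //= ?G0 /= ?mul0r ?scaler0 ?add0r //; try by lia.
all: case: (_ =P 0) => [e|_]; rewrite ?(mul0r, mulr0, oppr0, scaler0, scale0r, addr0) //.
all: try lia.
all: first [have -> : m = 0 by lia | have -> : n = 0 by lia].
all: by rewrite mulr0z ?(mul0r, mulr0, oppr0, scale0r).
Qed.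

Lemma lin_fct (T X : Type) (L : seq (CC * X)) (H : X -> T -> CC^o) t :
  (lin L H : T -> CC^o) t = lin L (fun x => H x t).
Proof.
elim: L => [|p L IH]; first by rewrite !lin_nil.
by rewrite !lin_cons -IH.
Qed.

(** The functional is obtained by mapping the prolongation into a module coinduced from $\mathfrak
    h+\mathfrak n_-$, in which [vacf] is a highest weight vector, and evaluating at $1$. *)
Lemma vacuum_functional (b : nat) (k : int) (V : lmodType CC) (rho : gen -> V -> V)
    (e : nat -> V) :
  (0 < b)%N -> is_prolongation false (spin b) k rho e ->
  exists phi : V -> CC^o,
    [/\ forall (c : CC) u v, phi (c *: u + v) = c *: phi u + phi v,
        phi (e 0%N) = 1 &
        forall x v, gnpos x -> phi (rho x v) = hw_weight (spin b) k x * phi v].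
Proof.
move=> b_gt0 prol; set lam := hw_weight (spin b) k.
(* Functionals on the enveloping algebra, given on reversed words, on which left multiplication by
   $\mathfrak h+\mathfrak n_-$ acts by the weight. *)
pose P (G : seq gen -> CC^o) :=
  (forall w' x y w, G (w' ++ y :: x :: w) - G (w' ++ x :: y :: w) =
     lin (br x y) (fun z => G (w' ++ z :: w))) /\
  (forall w x, gnpos x -> G (rcons w x) = lam x * G w).
(* Prepending to a reversed word is right multiplication, which makes this a left action on
   functionals. *)
pose sigma x (G : seq gen -> CC^o) : seq gen -> CC^o := fun w => G (x :: w).
have fctD c (G H : seq gen -> CC^o) w : (c *: G + H) w = c *: G w + H w by [].
have rP : rep_on P sigma.
  split=> //.
  - split; first by split=> [w' x y w|w x _]; [rewrite subr0 lin_const0|rewrite mulr0].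
    move=> c G H [G1 G2] [H1 H2]; split=> [w' x y w|w x nx].
      rewrite linD linZ -G1 -H1.
      by rewrite !fctD opprD addrACA scalerBr.
    by rewrite !fctD G2 // H2 // mulrDr; congr (_ + _); apply: mulrCA.
  - by move=> x G [G1 G2]; split=> [w' *|w y ny]; [apply: (G1 (x :: w'))|apply: (G2 (x :: w))].
  - move=> x y G [G1 _]; apply/funext => w; rewrite lin_fct.
    exact: (G1 [::] x y w).
pose F := @vacf CC gen br gneg lam.
have PF : P F.
  split=> [w' x y w|w x nx].
    apply: (@vacf_comm CC gen br gneg gnpos lam).
    - exact: lin_br_anti.
    - exact: br_jacobi.
    - exact: gneg_npos.
    - exact: br_npos_neg.
    - exact: br_nneg.
  apply: (@vacf_rcons CC gen br gneg gnpos lam) => //.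
  - exact: gneg_npos.
  - exact: hw_weight_neg.
  - exact: br_npos_neg.
(* The twist is needed because $|j,0\rangle_-$ is killed by $J^+_0$, whereas [hw_vector] asks for
   $J^-_0$. *)
have hF : hw_vector (spin b) k (flip sigma) F.
  have F_cons x : ~~ gneg x -> sigma x F = lam x *: F.
    by move=> nx; apply/funext => w; rewrite /sigma /F vacf_cons (negbTE nx).
  split=> [|||| n n_gt0].
  - by rewrite /= F_cons //= scaleNr.
  - by rewrite /= F_cons //= scale0r.
  - by rewrite /= F_cons.
  - by rewrite /= F_cons.
  - by split; rewrite /= F_cons /= -?leNgt -?ltNge ?(gt_eqF n_gt0) ?scale0r ?oppr0 //; lia.
have [f [f0 Pf relf]] := hw_vector_prol_rel b_gt0 (rep_on_flip rP) PF hF.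
have [g [lin_g int_g g_e Pg]] := prolongation_map prol rP Pf (prol_rel_flip relf).
exists (fun v => g v [::]); split=> [c u v||x v nx].
- by rewrite lin_g.
- by rewrite g_e f0 /F vacf_nil.
- by rewrite int_g; have [_ h] := Pg v; apply: (h [::] x nx).
Qed.

(** A block amounts to a $J$-equivariant map from the first module to the dual of the second,
    twisted by $J^a_n\mapsto-J^a_{-n}$. In this dual [phi] is a highest weight vector, so the
    universal property gives the map. *)
Lemma dual_block (b : nat) (k : int)
    (V1 : lmodType CC) (rho1 : gen -> V1 -> V1) (e1 : nat -> V1)
    (V2 : lmodType CC) (rho2 : gen -> V2 -> V2) (e2 : nat -> V2) :
  (0 < b)%N -> is_prolongation true (spin b) k rho1 e1 ->
  is_prolongation false (spin b) k rho2 e2 ->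
  exists beta, conf_block rho1 rho2 beta /\ beta (e1 0%N) (e2 0%N) = 1.
Proof.
move=> b_gt0 prol1 prol2.
have [phi [lin_phi phi_e phi_npos]] := vacuum_functional b_gt0 prol2.
have [/hsl2_repP [lin2 comm2] _ _] := prol2.
pose P (f : V2 -> CC^o) := forall (c : CC) u v, f (c *: u + v) = c *: f u + f v.
pose tau x := match x with
  | GJp n => GJp (- n) | GJm n => GJm (- n) | GJ0 n => GJ0 (- n) | _ => x end.
pose sg x : CC := match x with GK | Gd => 1 | _ => -1 end.
pose sigma x (f : V2 -> CC^o) : V2 -> CC^o := fun v => sg x *: f (rho2 (tau x) v).
have fctD c (G H : V2 -> CC^o) w : (c *: G + H) w = c *: G w + H w by [].
have P_lin f (X : Type) (L : seq (CC * X)) G : P f -> f (lin L G) = lin L (fun x => f (G x)).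
  move=> Pf; elim: L => [|p L IH]; rewrite ?lin_nil ?lin_cons; last by rewrite Pf IH.
  by have := Pf (-1) 0 0; rewrite scaler0 addr0 scaleN1r addNr.
(* The signed map [tau], fixing $K$ and $d$, is an anti-automorphism, so precomposition with it
   yields a left action on the dual. *)
have br_tau x y (H : gen -> CC^o) :
  (sg x * sg y) *: lin (br (tau y) (tau x)) H = lin (br x y) (fun z => sg z *: H (tau z)).
  case: x => [m|m|m||]; case: y => [n|n|n||];
    rewrite /= ?lin_cons ?lin_nil ?scaler0 ?addr0 //=.
  1-13: rewrite ?mulrNN ?mulr1 ?mul1r ?mulrN ?scaleN1r ?scale1r ?scaleNr
    ?scalerN ?opprK ?mulrNz ?opprK.
  1-13: try rewrite -(opprD m n).
  1-13: try rewrite -(opprD n m).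
  1-13: rewrite ?oppr_eq0 ?mulNr ?scaleNr ?opprK //.
  by rewrite -!mulrA (cocycle_anti _ m n) mulNr.
have rP : rep_on P sigma.
  split=> //.
  - by split=> [c u v|c f g Pf Pg d u v]; rewrite ?scaler0 ?addr0 //
      !fctD Pf Pg !scalerDr !scalerA addrACA mulrC.
  - move=> x c f g Pf Pg; apply/funext => v.
    by rewrite fctD /sigma fctD scalerDr !scalerA mulrC.
  - by move=> x f Pf c u v; rewrite /sigma lin2 Pf scalerDr !scalerA mulrC.
  - move=> x y f Pf; apply/funext => v; rewrite lin_fct.
    rewrite -[RHS](br_tau x y (fun z => f (rho2 z v))) -(P_lin f _ _ (rho2 ^~ v)) //.
    rewrite -comm2 /comm.
    have := Pf (-1) (rho2 (tau x) (rho2 (tau y) v)) (rho2 (tau y) (rho2 (tau x) v)).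
    rewrite scaleN1r [- _ + _]addrC => ->.
    rewrite scaleN1r scalerDr scalerN addrC -!scalerA.
    by rewrite [X in _ = - X + _]scalerA [sg x * sg y]mulrC -scalerA.
have Pphi : P phi by [].
have hphi : hw_vector (spin b) k sigma phi.
  split=> [||||n n_gt0].
  - by apply/funext => v; rewrite /sigma /= oppr0 phi_npos //= scaleN1r -mulNr.
  - by apply/funext => v; rewrite /sigma /= oppr0 phi_npos //= mul0r scaler0.
  - by apply/funext => v; rewrite /sigma /= phi_npos // scale1r.
  - by apply/funext => v; rewrite /sigma /= phi_npos // scale1r.
  - split; apply/funext => v; rewrite /sigma /= phi_npos /= ?oppr_lt0 ?oppr_le0 ?ltW //;
      by rewrite ?oppr_eq0 ?(gt_eqF n_gt0) mul0r scaler0.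
have [f [f0 Pf relf]] := hw_vector_prol_rel b_gt0 rP Pphi hphi.
have [g [lin_g int_g g_e Pg]] := prolongation_map prol1 rP Pf relf.
exists g; split; last by rewrite g_e f0.
split=> [c u u' v|c u v v'|n u v|n u v|n u v].
- by rewrite lin_g.
- exact: Pg.
- by rewrite int_g /sigma /= scaleN1r addNr.
- by rewrite int_g /sigma /= scaleN1r addNr.
- by rewrite int_g /sigma /= scaleN1r addNr.
Qed.

(** * Triangular decomposition *)

Section Triangular.
Variables (V : lmodType CC) (rho : gen -> V -> V) (k : CC) (e0 : V).
Hypothesis rT : rep_on (fun=> True) rho.
Hypothesis rhoK : forall v, rho GK v = k *: v.
Hypothesis Jp_e0 : forall n : int, 0 < n -> rho (GJp n) e0 = 0.
Hypothesis Jm_e0 : forall n : int, 0 < n -> rho (GJm n) e0 = 0.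
Hypothesis J0_e0 : forall n : int, 0 <= n -> exists c : CC, rho (GJ0 n) e0 = c *: e0.
Hypothesis e0_gen : forall P : V -> Prop, subspace P -> P e0 ->
  (forall n v, P v -> [/\ P (rho (GJp n) v), P (rho (GJm n) v) & P (rho (GJ0 n) v)]) ->
  forall v, P v.

Inductive closure (B : V -> Prop) (S : gen -> Prop) : V -> Prop :=
| closure_base v : B v -> closure B S v
| closure_zero : closure B S 0
| closure_lin (c : CC) u v : closure B S u -> closure B S v -> closure B S (c *: u + v)
| closure_act x v : S x -> closure B S v -> closure B S (rho x v).

Lemma closure_subspace B S : subspace (closure B S).
Proof. by split=> [|c u v Bu Bv]; [apply: closure_zero|apply: closure_lin]. Qed.

Lemma closure_stable (B : V -> Prop) (S : gen -> Prop) (P : V -> Prop) (f : V -> V) :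
  (forall (c : CC) u v, f (c *: u + v) = c *: f u + f v) -> subspace P ->
  (forall v, B v -> P (f v)) ->
  (forall x v, S x -> closure B S v -> P (f v) -> P (f (rho x v))) ->
  forall v, closure B S v -> P (f v).
Proof.
move=> lin_f sP base act v; elim=> {v} [//||c u v _ Pu _ Pv|x v Sx Bv Pv].
- have -> : f 0 = 0.
    by have := lin_f (-1) 0 0; rewrite scaler0 addr0 scaleN1r addNr.
  exact: subspace0 sP.
- by rewrite lin_f; apply: sP.2.
- exact: act.
Qed.

Definition Jm_word (s : seq int) : V := foldr (fun n => rho (GJm n)) e0 s.

Lemma rho_lin x (c : CC) u v : rho x (c *: u + v) = c *: rho x u + rho x v.
Proof. by case: rT => _ h _ _; apply: h. Qed.

Lemma rho_comm x y v : rho x (rho y v) = rho y (rho x v) + lin (br x y) (rho ^~ v).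
Proof. exact: (rep_on_swap rT). Qed.

(** The three layers are built from the inside outwards: $J^-$ words on [e0], then negative $J^0$
    modes, then nonpositive $J^+$ modes. The lemmas below show that [Tp] is stable under every mode,
    hence is everything; only spanning is claimed. *)
Let Tm := closure (fun v => exists2 s, all (<= 0) s & v = Jm_word s) (fun=> False).
Let T0 := closure Tm (fun x => exists2 n, n < 0 & x = GJ0 n).
Let Tp := closure T0 (fun x => exists2 n, n <= 0 & x = GJp n).

Let sTm : subspace Tm := closure_subspace _ _.
Let sT0 : subspace T0 := closure_subspace _ _.
Let sTp : subspace Tp := closure_subspace _ _.

Let TmT0 v : Tm v -> T0 v. Proof. exact: closure_base. Qed.
Let T0Tp v : T0 v -> Tp v. Proof. exact: closure_base. Qed.

Lemma Jm_word_comm n s : rho (GJm n) e0 = 0 -> rho (GJm n) (Jm_word s) = 0.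
Proof.
move=> ne0; elim: s => [//|m s IH] /=.
by rewrite rho_comm IH lin_nil (rep_on0 rT) addr0.
Qed.

Lemma Tm_Jm n v : Tm v -> Tm (rho (GJm n) v).
Proof.
apply: closure_stable => //; first exact: rho_lin.
move=> _ [s s_le0 ->]; have [n_le0|n_gt0] := leP n 0.
  by apply: closure_base; exists (n :: s); rewrite //= n_le0.
by rewrite Jm_word_comm ?Jm_e0 //; apply: (subspace0 sTm).
Qed.

Lemma Tm_J0 n v : 0 <= n -> Tm v -> Tm (rho (GJ0 n) v).
Proof.
move=> n_ge0; apply: closure_stable => //; first exact: rho_lin.
move=> _ [s s_le0 ->]; elim: s s_le0 => [_|m s IH /= /andP[m_le0 s_le0]].
  by have [c ->] := J0_e0 n_ge0; apply: (subspaceZ _ sTm); apply: closure_base; exists [::].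
rewrite rho_comm /= lin_cons lin_nil addr0; apply: (subspaceD sTm).
  by apply: Tm_Jm; apply: IH.
by apply: (subspaceZ _ sTm); apply: Tm_Jm; apply: closure_base; exists s.
Qed.

Lemma T0_J0_neg n v : n < 0 -> T0 v -> T0 (rho (GJ0 n) v).
Proof. by move=> n_lt0; apply: closure_act; exists n. Qed.

Lemma T0_J0 n v : T0 v -> T0 (rho (GJ0 n) v).
Proof.
have [n_ge0|n_lt0] := leP 0 n; last exact: T0_J0_neg.
apply: closure_stable => //; [exact: rho_lin|by move=> u Tu; apply/TmT0/Tm_J0|].
move=> _ u [m m_lt0 ->] Tu IH; rewrite rho_comm /= lin_cons lin_nil addr0 /= rhoK.
apply: (subspaceD sT0); first exact: T0_J0_neg.
by do 2! apply: (subspaceZ _ sT0).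
Qed.

(** The mode is quantified inside the induction because moving $J^-_n$ past $J^0_m$ changes it to
    $m+n$. *)
Lemma T0_Jm v : T0 v -> forall n, T0 (rho (GJm n) v).
Proof.
elim=> {v} [v Tv n|n|c u v _ IHu _ IHv n|_ v [m m_lt0 ->] Tv IH n].
- exact/TmT0/Tm_Jm.
- by rewrite (rep_on0 rT); apply: (subspace0 sT0).
- by rewrite rho_lin; apply: sT0.2; [apply: IHu|apply: IHv].
- rewrite rho_comm /= lin_cons lin_nil addr0; apply: (subspaceD sT0).
    exact: T0_J0_neg.
  by apply: (subspaceZ _ sT0); apply: IH.
Qed.

Lemma Tp_Jp n v : n <= 0 -> Tp v -> Tp (rho (GJp n) v).
Proof. by move=> n_le0; apply: closure_act; exists n. Qed.

(** Restricted to nonpositive modes, whose brackets with the outer $J^+_m$ are again allowed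
    letters. Arbitrary modes must wait for [T0_Jp]. *)
Lemma Tp_J0_nonpos n v : n <= 0 -> Tp v -> Tp (rho (GJ0 n) v).
Proof.
move=> n_le0; apply: closure_stable => //; [exact: rho_lin|by move=> u Tu; apply/T0Tp/T0_J0|].
move=> _ u [m m_le0 ->] Tu IH; rewrite rho_comm /= lin_cons lin_nil addr0 /=.
apply: (subspaceD sTp); first exact: Tp_Jp.
by apply: (subspaceZ _ sTp); apply: Tp_Jp => //; lia.
Qed.

Lemma Tp_Jm_nonpos n v : n <= 0 -> Tp v -> Tp (rho (GJm n) v).
Proof.
move=> n_le0; apply: closure_stable => //; [exact: rho_lin|by move=> u Tu; apply/T0Tp/T0_Jm|].
move=> _ u [m m_le0 ->] Tu IH; rewrite rho_comm /= !lin_cons lin_nil addr0 /= rhoK.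
apply: (subspaceD sTp); first exact: Tp_Jp.
apply: (subspaceD sTp); last by do 2! apply: (subspaceZ _ sTp).
by apply: (subspaceZ _ sTp); apply: Tp_J0_nonpos => //; lia.
Qed.

(** Here $J^+_n$ is commuted inwards until it meets [e0]. The letters it passes have nonpositive
    modes and act on vectors already in [Tp]. *)
Lemma T0_Jp v : T0 v -> forall n, Tp (rho (GJp n) v).
Proof.
elim=> {v} [v Tv n|n|c u v _ IHu _ IHv n|_ v [m m_lt0 ->] Tv IH n].
- move: v Tv; apply: closure_stable => //; first exact: rho_lin.
  move=> _ [s s_le0 ->]; elim: s s_le0 => [_|m s IH /= /andP[m_le0 s_le0]].
    have [n_le0|n_gt0] := leP n 0; last by rewrite Jp_e0 //; apply: (subspace0 sTp).
    by apply: Tp_Jp => //; apply/T0Tp/TmT0; apply: closure_base; exists [::].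
  have Ts : T0 (Jm_word s) by apply: TmT0; apply: closure_base; exists s.
  rewrite rho_comm /= !lin_cons lin_nil addr0 /= rhoK.
  apply: (subspaceD sTp); first by apply: Tp_Jm_nonpos => //; apply: IH.
  apply: (subspaceD sTp); last by do 2! apply: (subspaceZ _ sTp); apply: T0Tp.
  by apply: (subspaceZ _ sTp); apply/T0Tp/T0_J0.
- by rewrite (rep_on0 rT); apply: (subspace0 sTp).
- by rewrite rho_lin; apply: sTp.2; [apply: IHu|apply: IHv].
- rewrite rho_comm /= lin_cons lin_nil addr0; apply: (subspaceD sTp).
    by apply: Tp_J0_nonpos; [apply: ltW|apply: IH].
  by apply: (subspaceZ _ sTp); apply: IH.
Qed.

Lemma Tp_stable v : Tp v -> forall n,
  [/\ Tp (rho (GJp n) v), Tp (rho (GJm n) v) & Tp (rho (GJ0 n) v)].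
Proof.
elim=> {v} [v Tv n|n|c u v _ IHu _ IHv n|_ v [m m_le0 ->] Tv IH n].
- by split; [apply: T0_Jp|apply/T0Tp/T0_Jm|apply/T0Tp/T0_J0].
- by rewrite !(rep_on0 rT); split; apply: (subspace0 sTp).
- have [u1 u2 u3] := IHu n; have [v1 v2 v3] := IHv n.
  by split; rewrite rho_lin; apply: sTp.2.
have [Tpv Tmv T0v] := IH n.
split; rewrite rho_comm /= ?lin_cons ?lin_nil ?addr0 /=.
- exact: Tp_Jp.
- apply: (subspaceD sTp); first exact: Tp_Jp.
  rewrite rhoK; apply: (subspaceD sTp); last by do 2! apply: (subspaceZ _ sTp).
  by apply: (subspaceZ _ sTp); have [] := IH (m + n).
- apply: (subspaceD sTp); first exact: Tp_Jp.
  by apply: (subspaceZ _ sTp); have [] := IH (n + m).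
Qed.

Lemma triangular_vanish (phi : V -> CC^o) :
  (forall (c : CC) u v, phi (c *: u + v) = c *: phi u + phi v) ->
  (forall (n : int) v, n <= 0 -> phi (rho (GJp n) v) = 0) ->
  (forall (n : int) v, n < 0 -> phi (rho (GJ0 n) v) = 0) ->
  (forall s, all (<= 0) s -> phi (Jm_word s) = 0) ->
  forall v, phi v = 0.
Proof.
move=> lin_phi phi_p phi_0 phi_m v.
have phi0 : phi 0 = 0.
  by have := lin_phi (-1) 0 0; rewrite scaler0 addr0 scaleN1r addNr.
have : Tp v.
  move: v; apply: e0_gen => //; last by move=> n v Tv; apply: Tp_stable.
  by apply/T0Tp/TmT0; apply: closure_base; exists [::].
elim=> {v} [v||c u v _ + _ +|_ v [m m_le0 ->] _ _]; last exact: phi_p; last 1 first.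
- by rewrite lin_phi => -> ->; rewrite scaler0 addr0.
- elim=> {v} [v||c u v _ + _ +|_ v [m m_lt0 ->] _ _]; last exact: phi_0; last 1 first.
  + by rewrite lin_phi => -> ->; rewrite scaler0 addr0.
  + elim=> {v} [_ [s s_le0 ->]||c u v _ + _ +|//]; [exact: phi_m|exact: phi0|].
    by rewrite lin_phi => -> ->; rewrite scaler0 addr0.
  + exact: phi0.
- exact: phi0.
Qed.

Lemma Jm_word_weight (c : CC) s : rho (GJ0 0) e0 = c *: e0 ->
  rho (GJ0 0) (Jm_word s) = (c - 2 * (size s)%:R) *: Jm_word s.
Proof.
move=> wt; elim: s => [|m s IH]; first by rewrite /= wt mulr0 subr0.
rewrite /= rho_comm IH (rep_onZ rT) // /= lin_cons lin_nil addr0 add0r /= -scalerDl.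
by congr (_ *: _); rewrite -(natr1 (size s)) mulrDr mulr1 [in RHS]opprD [in RHS]addrA.
Qed.

End Triangular.

(** * Conformal blocks *)

Lemma int_weight_eq0 (x y : int) (z : CC) :
  x != y -> x%:~R * z = y%:~R * z -> z = 0.
Proof.
move=> xy /eqP; rewrite -subr_eq0 -mulrBl -rmorphB mulf_eq0 intr_eq0 subr_eq0.
by rewrite (negbTE xy) => /eqP.
Qed.

Section Blocks.
Variables (k : int) (a b : nat) (s t : int).
Variables (V1 : lmodType CC) (rho1 : gen -> V1 -> V1) (e1 : nat -> V1).
Variables (V2 : lmodType CC) (rho2 : gen -> V2 -> V2) (e2 : nat -> V2).
Hypotheses (a_gt0 : (1 <= a)%N) (a_le : a%:Z <= - k - 1).
Hypotheses (b_gt0 : (1 <= b)%N) (b_le : b%:Z <= - k - 1).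
Hypothesis prol1 : is_prolongation true (spin a) k rho1 e1.
Hypothesis prol2 : is_prolongation false (spin b) k rho2 e2.

Lemma block_eq0 (beta : V1 -> V2 -> CC) :
  conf_block (sflow s rho1) (sflow (- t) rho2) beta ->
  (a = b -> s = t -> beta (e1 0%N) (e2 0%N) = 0) ->
  forall u v, beta u v = 0.
Proof.
move=> [linl linr bp bm b0] beta_e u v.
have [/hsl2_repP [lin1 _] [[J0e1 _ Jme1] _ pos1 _] _] := prol1.
have [/hsl2_repP [lin2 _] [[J0e2 Jpe2 _] _ pos2 _] _] := prol2.
have [rep1 _ _] := prol1; have [rep2 _ _] := prol2.
have rT1 : rep_on (fun=> True) rho1 by apply: hsl2_rep_on.
(* Undoing both spectral flows leaves a single mode shift by $t-s$, with the opposite sign for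
   $J^-$. *)
have bp' m x y : beta (rho1 (GJp m) x) y = - beta x (rho2 (GJp (t - s - m)) y).
  apply/eqP; rewrite -addr_eq0; apply/eqP; have := bp (m + s) x y; rewrite /= addrK.
  by rewrite (_ : - (m + s) - - t = t - s - m) //; ring.
have bm' m x y : beta (rho1 (GJm m) x) y = - beta x (rho2 (GJm (s - t - m)) y).
  apply/eqP; rewrite -addr_eq0; apply/eqP; have := bm (m - s) x y; rewrite /= subrK.
  by rewrite (_ : - (m - s) - t = s - t - m) //; ring.
have betal0 y : beta 0 y = 0.
  by have := linl (-1) 0 0 y; rewrite scaler0 addr0 mulN1r addNr.
have betar0 x : beta x 0 = 0.
  by have := linr (-1) x 0 0; rewrite scaler0 addr0 mulN1r addNr.
have betaZl c x y : beta (c *: x) y = c * beta x y.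
  by have := linl c x 0 y; rewrite addr0 betal0 addr0.
have betaZr c x y : beta x (c *: y) = c * beta x y.
  by have := linr c x y 0; rewrite addr0 betar0 addr0.
have betaN x y : beta (- x) y = - beta x y by rewrite -scaleN1r betaZl mulN1r.
have b0' m x y : m != 0 -> beta (rho1 (GJ0 m) x) y = - beta x (rho2 (GJ0 (- m)) y).
  move=> m0; apply/eqP; rewrite -addr_eq0; apply/eqP; have := b0 m x y.
  by rewrite /= oppr_eq0 (negbTE m0) !mulr0 !scale0r !subr0.
have b00 x : beta (rho1 (GJ0 0) x) (e2 0%N) = (b%:Z + (s - t) * k)%:~R * beta x (e2 0%N).
  have := b0 0 x (e2 0%N); rewrite /= oppr0 ?eqxx ?mulr1.
  rewrite (prolongation_K a_gt0 prol1) (prolongation_K b_gt0 prol2) J0e2 subr0 double_spin.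
  rewrite !scalerA.
  have -> : rho1 (GJ0 0) x - (s%:~R * k%:~R) *: x = (- (s%:~R * k%:~R)) *: x + rho1 (GJ0 0) x.
    by rewrite scaleNr addrC.
  rewrite linl -scalerBl betaZr.
  have ringE (R : comNzRingType) (S T K B X Y : R) :
      - (S * K) * X + Y + (- B - - T * K) * X = 0 -> Y = (B + (S - T) * K) * X.
    by move=> h; rewrite -[RHS]addr0 -[in RHS]h; ring.
  rewrite intrD intrM intrB mulrNz -pmulrn; exact: (ringE CC _ _ _ b%:R).
(* The block identities move any mode off the second argument, which is generated from [e2 0]. *)
have e2_gen : (forall x, beta x (e2 0%N) = 0) -> beta u v = 0.
  move=> h; move: v u; apply: (prolongation_ind b_gt0 prol2 (P := fun v => forall u, beta u v = 0)).
  - by split=> // c v w hv hw u; rewrite linr hv hw mulr0 addr0.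
  - by [].
  move=> n v hv; split=> u.
  - have := bp' (t - s - n) u v; rewrite hv (_ : t - s - (t - s - n) = n); last by ring.
    by move/eqP; rewrite eq_sym oppr_eq0 => /eqP.
  - have := bm' (s - t - n) u v; rewrite hv (_ : s - t - (s - t - n) = n); last by ring.
    by move/eqP; rewrite eq_sym oppr_eq0 => /eqP.
  - have := b0 (- n) u v; rewrite hv add0r /= opprK.
    by rewrite (prolongation_K b_gt0 prol2) scalerA -scaleNr addrC linr hv mulr0 add0r.
apply: e2_gen => {u v}.
have e1_gen (P : V1 -> Prop) := prolongation_ind a_gt0 prol1 (P := P).
have K1 := prolongation_K a_gt0 prol1.
have Jp2 n : 0 <= n -> rho2 (GJp n) (e2 0%N) = 0.
  rewrite le_eqVlt => /predU1P[<-|/(pos2 n 0%N)[]//].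
  by rewrite Jpe2 mul0r sqrtC0 scale0r oppr0.
have Jm1 n : 0 <= n -> rho1 (GJm n) (e1 0%N) = 0.
  rewrite le_eqVlt => /predU1P[<-|/(pos1 n 0%N)[]//].
  by rewrite Jme1 mul0r sqrtC0 scale0r oppr0.
have wt1 : rho1 (GJ0 0) (e1 0%N) = a%:R *: e1 0%N.
  by rewrite J0e1 sub0r mulrN double_spin opprK.
have J01 n : 0 <= n -> exists c : CC, rho1 (GJ0 n) (e1 0%N) = c *: e1 0%N.
  rewrite le_eqVlt => /predU1P[<-|/(pos1 n 0%N)[_ _ ->]]; first by exists a%:R.
  by exists 0; rewrite scale0r.
have phi_0 n x : n < 0 -> beta (rho1 (GJ0 n) x) (e2 0%N) = 0.
  move=> n_lt0; rewrite b0' ?lt_eqF //.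
  by have [|_ _ ->] := pos2 (- n) 0%N; rewrite ?oppr_gt0 // betar0 oppr0.
(* If $s\le t$, a $J^+_n$ with $n\le0$ is transferred to mode $t-s-n\ge0$, which kills [e2 0], so
   only $J^-$ words remain. If $t<s$, a $J^-_n$ with $n\le0$ goes to mode $s-t-n>0$, and $J^+$ words
   remain. *)
have [s_le_t|t_lt_s] := leP s t.
  apply: (@triangular_vanish V1 rho1 k%:~R (e1 0%N) rT1 K1 _ _ J01 e1_gen (beta ^~ (e2 0%N))).
  - by move=> n /(pos1 n 0%N)[].
  - by move=> n /(pos1 n 0%N)[].
  - by move=> c x y; rewrite linl.
  - by move=> n x n_le0; rewrite bp' Jp2 ?betar0 ?oppr0 //; lia.
  - exact: phi_0.
  move=> w w_le0.
  have wt_w := b00 (Jm_word rho1 (e1 0%N) w).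
  rewrite (Jm_word_weight rT1 w wt1) betaZl in wt_w.
  have {wt_w} wt_w : (a%:Z - 2 * (size w)%:Z)%:~R * beta (Jm_word rho1 (e1 0%N) w) (e2 0%N) =
    (b%:Z + (s - t) * k)%:~R * beta (Jm_word rho1 (e1 0%N) w) (e2 0%N).
    by rewrite -wt_w rmorphB rmorphM.
  have [ab|/int_weight_eq0/(_ wt_w)//] := eqVneq (a%:Z - 2 * (size w)%:Z) (b%:Z + (s - t) * k).
  (* If $t-s\ge1$, the right side is at least $1-k$, while the left side is at most $a\le-k-1$. *)
  have st : s = t by nia.
  case: w w_le0 {wt_w} ab => [_|m w /= /andP[m_le0 _] _].
    by rewrite st subrr mul0r /= => ab; apply: beta_e => //; lia.
  (* A leading $J^-_0$ commutes through to [e1 0] and kills it; a leading $J^-_m$ with $m<0$ is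
     transferred to a positive mode on [e2 0]. *)
  move: m_le0; rewrite le_eqVlt => /predU1P[->|m_lt0].
    by rewrite Jm_word_comm ?Jm1.
  rewrite bm' st subrr sub0r.
  by have [|_ -> _] := pos2 (- m) 0%N; rewrite ?oppr_gt0 // betar0 oppr0.
have K1' v : flip rho1 GK v = k%:~R *: v by apply: K1.
have wt1' : flip rho1 (GJ0 0) (e1 0%N) = (- a%:R) *: e1 0%N by rewrite /= wt1 scaleNr.
apply: (@triangular_vanish V1 (flip rho1) k%:~R (e1 0%N) (rep_on_flip rT1) K1' _ _ _ _
          (beta ^~ (e2 0%N))).
- by move=> n /(pos1 n 0%N)[].
- by move=> n /(pos1 n 0%N)[].
- by move=> n /J01 [c /= ->]; exists (- c); rewrite scaleNr.
- move=> P sP P0 stP; apply: e1_gen => // n v /(stP n)[/= h1 h2 /(subspaceN sP)].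
  by rewrite opprK.
- by move=> c x y; rewrite linl.
- move=> n x n_le0; rewrite /= bm'.
  have [|_ -> _] := pos2 (s - t - n) 0%N; last by rewrite betar0 oppr0.
  by lia.
- by move=> n x n_lt0; rewrite /= betaN phi_0 ?oppr0.
move=> w _; have wt_w := b00 (Jm_word (flip rho1) (e1 0%N) w).
have /= := Jm_word_weight (rep_on_flip rT1) w wt1'.
move/(congr1 (fun x => - beta x (e2 0%N))); rewrite betaN opprK wt_w betaZl => {}wt_w.
(* The weights never agree: $b+(s-t)k\le b+k\le-1$, whereas $a+2p$ is positive for a word of length
   $p$. *)
apply: (@int_weight_eq0 (b%:Z + (s - t) * k) (a%:Z + 2 * (size w)%:Z)); first by nia.
by rewrite wt_w rmorphD rmorphM -mulNr opprB addrC opprK.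
Qed.

End Blocks.

(** * Spectral flow, differences and transposition of blocks *)

Lemma conf_block_sflow (V1 V2 : lmodType CC) (rho1 : gen -> V1 -> V1)
    (rho2 : gen -> V2 -> V2) (beta : V1 -> V2 -> CC) (s : int) :
  (forall u v, beta (rho1 GK u) v = beta u (rho2 GK v)) ->
  conf_block rho1 rho2 beta -> conf_block (sflow s rho1) (sflow (- s) rho2) beta.
Proof.
move=> betaK [linl linr bp bm b0]; split=> // n u v /=.
- by rewrite -(bp (n - s) u v) opprB opprK [s - n]addrC.
- by rewrite -(bm (n + s) u v) opprD.
(* The central shifts of $J^0_0$ on the two sides are opposite and cancel by [betaK]. *)
rewrite oppr_eq0 -!scaleNr ![rho1 _ _ + _]addrC ![rho2 _ _ + _]addrC linl linr betaK.
by rewrite addrACA b0 addr0 mulrNz !mulNr opprK addNr.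
Qed.

Lemma conf_block_sub (V1 V2 : lmodType CC) (rho1 : gen -> V1 -> V1)
    (rho2 : gen -> V2 -> V2) (beta beta' : V1 -> V2 -> CC) (c : CC) :
  conf_block rho1 rho2 beta -> conf_block rho1 rho2 beta' ->
  conf_block rho1 rho2 (fun u v => beta u v - c * beta' u v).
Proof.
move=> [l1 l2 p m z] [l1' l2' p' m' z']; split=> [d u u' v|d u v v'|n u v|n u v|n u v].
- by rewrite l1 l1' mulrDr opprD addrACA mulrBr mulrCA.
- by rewrite l2 l2' mulrDr opprD addrACA mulrBr mulrCA.
- by rewrite addrACA p -opprD -mulrDr p' mulr0 subr0.
- by rewrite addrACA m -opprD -mulrDr m' mulr0 subr0.
- by rewrite addrACA z -opprD -mulrDr z' mulr0 subr0.
Qed.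

Lemma conf_block_transpose (V1 V2 : lmodType CC) (rho1 : gen -> V1 -> V1)
    (rho2 : gen -> V2 -> V2) (beta : V1 -> V2 -> CC) :
  conf_block rho1 rho2 beta -> conf_block rho2 rho1 (fun v u => beta u v).
Proof.
move=> [l1 l2 p m z]; split=> // n v u; rewrite addrC.
- by rewrite -{2}[n]opprK p.
- by rewrite -{2}[n]opprK m.
- by rewrite -{2}[n]opprK z.
Qed.

Lemma blocks_dim1_transpose (V1 V2 : lmodType CC) (rho1 : gen -> V1 -> V1)
    (rho2 : gen -> V2 -> V2) : blocks_dim1 rho1 rho2 -> blocks_dim1 rho2 rho1.
Proof.
move=> [beta [blk [u [v nz]] uniq]]; exists (fun v u => beta u v); split.
- exact: conf_block_transpose.
- by exists v, u.
move=> beta' /conf_block_transpose /uniq [c h].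
by exists c => x y; rewrite -h.
Qed.

Lemma blocks_zero_transpose (V1 V2 : lmodType CC) (rho1 : gen -> V1 -> V1)
    (rho2 : gen -> V2 -> V2) : blocks_zero rho1 rho2 -> blocks_zero rho2 rho1.
Proof. by move=> h beta /conf_block_transpose /h h0 u v; apply: h0. Qed.

Lemma blocks_plus_minus (k : int) (a b : nat) (s t : int)
    (V1 : lmodType CC) (rho1 : gen -> V1 -> V1) (e1 : nat -> V1)
    (V2 : lmodType CC) (rho2 : gen -> V2 -> V2) (e2 : nat -> V2) :
  (1 <= a)%N -> a%:Z <= - k - 1 -> (1 <= b)%N -> b%:Z <= - k - 1 ->
  is_prolongation true (spin a) k rho1 e1 ->
  is_prolongation false (spin b) k rho2 e2 ->
  if (a == b) && (s == t)
  then blocks_dim1 (sflow s rho1) (sflow (- t) rho2)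
  else blocks_zero (sflow s rho1) (sflow (- t) rho2).
Proof.
move=> a_gt0 a_le b_gt0 b_le prol1 prol2.
have vanish := block_eq0 (s := s) (t := t) a_gt0 a_le b_gt0 b_le prol1 prol2.
case: ifP => [/andP[/eqP ab /eqP st]|ne beta blk u v]; last first.
  by apply: vanish => // ab st; rewrite ab st !eqxx in ne.
subst b t; have [beta0 [blk0 beta0_e]] := dual_block a_gt0 prol1 prol2.
have blk0s : conf_block (sflow s rho1) (sflow (- s) rho2) beta0.
  apply: conf_block_sflow => // u v; have [l1 l2 _ _ _] := blk0.
  rewrite (prolongation_K a_gt0 prol1) (prolongation_K a_gt0 prol2).
  have -> : beta0 (k%:~R *: u) v = k%:~R * beta0 u v.
    have z : beta0 0 v = 0 by have := l1 (-1) 0 0 v; rewrite scaler0 addr0 mulN1r addNr.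
    by have := l1 k%:~R u 0 v; rewrite !addr0 z addr0.
  have z : beta0 u 0 = 0 by have := l2 (-1) u 0 0; rewrite scaler0 addr0 mulN1r addNr.
  by have := l2 k%:~R u v 0; rewrite !addr0 z addr0.
exists beta0; split=> //; first by exists (e1 0%N), (e2 0%N); rewrite beta0_e oner_neq0.
(* Since [beta0] is $1$ on the two generating vectors, the difference vanishes there, hence
   everywhere. *)
move=> beta blk; exists (beta (e1 0%N) (e2 0%N)) => u v; apply/eqP; rewrite -subr_eq0; apply/eqP.
move: u v; apply: vanish; first exact: conf_block_sub.
by rewrite beta0_e mulr1 subrr.
Qed.

Unset Implicit Arguments.

(* i = spin a = -a/2, j = spin b = -b/2; eps = true is the sign (+, -),
   eps = false the sign (-, +). *)
Theorem theorem3p16 (k : int) (a b : nat) (s t : int) (eps : bool)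
  (V1 : lmodType CC) (rho1 : gen -> V1 -> V1) (e1 : nat -> V1)
  (V2 : lmodType CC) (rho2 : gen -> V2 -> V2) (e2 : nat -> V2) :
  k <= -3 ->
  (1 <= a)%N -> (a%:Z <= - k - 1) ->
  (1 <= b)%N -> (b%:Z <= - k - 1) ->
  is_prolongation eps (spin a) k rho1 e1 ->
  is_prolongation (~~ eps) (spin b) k rho2 e2 ->
  if (a == b) && (s == t)
  then blocks_dim1 (sflow s rho1) (sflow (- t) rho2)
  else blocks_zero (sflow s rho1) (sflow (- t) rho2).
Proof.
move=> _ a_gt0 a_le b_gt0 b_le; case: eps => /= prol1 prol2.
  exact: blocks_plus_minus prol1 prol2.
(* Exchanging the points replaces the pair of flows $(s,-t)$ by $(-t,s)$, which is the same form
   with $(s,t)$ replaced by $(-t,-s)$. *)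
have := blocks_plus_minus (- t) (- s) b_gt0 b_le a_gt0 a_le prol2 prol1.
rewrite opprK eqr_opp [b == a]eq_sym [t == s]eq_sym.
by case: ifP => _; [apply: blocks_dim1_transpose|apply: blocks_zero_transpose].
Qed.
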